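(* A locally $\mathbb{BC}$-convex module $(X,\tau)$ is $\mathbb{D}$-metrizable if and only if its topology $\tau$ is generated by a countable separated family $\mathcal{P}$ of $\mathbb{D}$-valued seminorms on $X$.
   Context: Bicomplex numbers: $\mathbb{BC} = \{w_1 + j w_2 : w_1, w_2 \in \mathbb{C}(i)\}$, where $\mathbb{C}(i)$ is the field of complex numbers with imaginary unit $i$; it is a commutative ring with $i^2=j^2=-1$, $ij=ji=k$, $k^2=1$. Put $e_1=(1+k)/2$, $e_2=(1-k)/2$, so $e_1^2=e_1$, $e_2^2=e_2$, $e_1e_2=0$, $e_1+e_2=1$. Every $Z\in\mathbb{BC}$ is uniquely $Z=e_1z_1+e_2z_2$ with $z_1,z_2\in\mathbb{C}(i)$; $\mathbb{BC}$ carries the topology of the Euclidean norm $|Z|=\sqrt{(|z_1|^2+|z_2|^2)/2}$. Hyperbolic numbers: $\mathbb{D}=\{e_1\alpha_1+e_2\alpha_2:\alpha_1,\alpha_2\in\mathbb{R}\}\subset\mathbb{BC}$; $\mathbb{D}^+=\{e_1\alpha_1+e_2\alpha_2:\alpha_1,\alpha_2\ge 0\}$. For $\alpha,\gamma\in\mathbb{D}$: $\alpha\leq'\gamma$ means $\gamma-\alpha\in\mathbb{D}^+$; $\alpha<'\gamma$ means $\gamma-\alpha=e_1a+e_2b$ with real $a,b>0$. The hyperbolic modulus is $|e_1z_1+e_2z_2|_k=e_1|z_1|+e_2|z_2|$. A topological $\mathbb{BC}$-module is a $\mathbb{BC}$-module $X$ with a Hausdorff topology $\tau$ such that addition $X\times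 X\to X$ and scalar multiplication $\mathbb{BC}\times X\to X$ are continuous. A subset $B\subset X$ is $\mathbb{BC}$-convex if $\lambda x+(1-\lambda)y\in B$ for all $x,y\in B$ and $\lambda\in\mathbb{D}^+$ with $0\leq'\lambda\leq'1$. A topological $\mathbb{BC}$-module is locally $\mathbb{BC}$-convex if it has a neighbourhood base at $0$ of $\mathbb{BC}$-convex sets. A $\mathbb{D}$-valued seminorm on $X$ is $p:X\to\mathbb{D}$ with $p(\lambda x)=|\lambda|_k\,p(x)$ and $p(x+y)\leq' p(x)+p(y)$ for all $x,y\in X$, $\lambda\in\mathbb{BC}$. A family $\mathcal{P}$ of $\mathbb{D}$-valued seminorms is separated if for each $x\ne0$ there is $p\in\mathcal{P}$ with $p(x)\neq0$. The topology $\tau_{\mathcal{P}}$ generated by $\mathcal{P}$ is the one with base consisting of all sets $U(x,\epsilon,p_1,\dots,p_n)=\{y\in X: p_m(y-x)<'\epsilon,\ m=1,\dots,n\}$ with $x\in X$, $\epsilon>'0$, $n\in\mathbb{N}$, $p_1,\dots,p_n\in\mathcal{P}$. A $\mathbb{D}$-valued metric on $X$ is $d:X\times X\to\mathbb{D}$ such that for all $x,y,z$: $d(x,y)\geq'0$, with $d(x,y)=0$ iff $x=y$; $d(x,y)=d(y,x)$; $d(x,z)\leq' d(x,y)+d(y,z)$. The topology it generates has as base the balls $\{y: d(x,y)<'\epsilon\}$, $x\in X$, $\epsilon>'0$. A topological $\mathbb{BC}$-module is $\mathbb{D}$-metrizable (hyperbolic metrizable) if its topology is generated by a $\mathbb{D}$-valued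 metric. *)

(* Defs.v *)
From HB Require Import structures.
From mathcomp Require Import all_boot all_order all_algebra.
From mathcomp Require Import complex ring.
From mathcomp Require Import all_classical all_reals all_analysis.

Set Implicit Arguments.
Unset Strict Implicit.
Unset Printing Implicit Defensive.

Import Order.TTheory GRing.Theory Num.Theory.
Import ComplexField.Normc.

Local Open Scope classical_set_scope.
Local Open Scope ring_scope.

(* [Bicomplex w1 w2] stands for w1 + j w2. *)
Record bicomplex (R : Type) : Type := Bicomplex { bc1 : R[i]; bc2 : R[i] }.

Section bicomplex_choice.
Variable R : Type.

Definition pair_of_bicomplex (Z : bicomplex R) : R[i] * R[i] := (bc1 Z, bc2 Z).
Definition bicomplex_of_pair (w : R[i] * R[i]) : bicomplex R :=
  Bicomplex w.1 w.2.

Lemma pair_of_bicomplexK : cancel pair_of_bicomplex bicomplex_of_pair.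
Proof. by case. Qed.

End bicomplex_choice.

HB.instance Definition _ (R : choiceType) :=
  Choice.copy (bicomplex R) (can_type (@pair_of_bicomplexK R)).

Section bicomplex_ring.
Variable R : realType.
Implicit Types Z W : bicomplex R.

Lemma bicomplexP Z W : bc1 Z = bc1 W -> bc2 Z = bc2 W -> Z = W.
Proof. by case: Z W => [a b] [c d] /= -> ->. Qed.

Definition addbc Z W := Bicomplex (bc1 Z + bc1 W) (bc2 Z + bc2 W).
Definition oppbc Z := Bicomplex (- bc1 Z) (- bc2 Z).
Definition mulbc Z W := Bicomplex (bc1 Z * bc1 W - bc2 Z * bc2 W)
                                  (bc1 Z * bc2 W + bc2 Z * bc1 W).

Lemma addbcA : associative addbc.
Proof. by move=> *; rewrite /addbc /= !addrA. Qed.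
Lemma addbcC : commutative addbc.
Proof. by move=> Z W; rewrite /addbc addrC [bc2 Z + _]addrC. Qed.
Lemma add0bc : left_id (Bicomplex 0 0) addbc.
Proof. by case=> a b; rewrite /addbc /= !add0r. Qed.
Lemma addNbc : left_inverse (Bicomplex 0 0) oppbc addbc.
Proof. by case=> a b; rewrite /addbc /= !addNr. Qed.

HB.instance Definition _ :=
  GRing.isZmodule.Build (bicomplex R) addbcA addbcC add0bc addNbc.

Lemma mulbcA : associative mulbc.
Proof. by move=> *; apply: bicomplexP => /=; ring. Qed.
Lemma mulbcC : commutative mulbc.
Proof. by move=> *; apply: bicomplexP => /=; ring. Qed.
Lemma mul1bc : left_id (Bicomplex 1 0) mulbc.
Proof. by move=> *; apply: bicomplexP => /=; ring. Qed.
Lemma mulbcDl : left_distributive mulbc addbc.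
Proof. by move=> *; apply: bicomplexP => /=; ring. Qed.
Lemma onebc_neq0 : Bicomplex 1 0 != 0 :> bicomplex R.
Proof. by apply/eqP => -[/eqP]; rewrite oner_eq0. Qed.

HB.instance Definition _ := GRing.Zmodule_isComNzRing.Build (bicomplex R)
  mulbcA mulbcC mul1bc mulbcDl onebc_neq0.

End bicomplex_ring.

Section idempotents.
Variable R : realType.
Implicit Types Z W : bicomplex R.

Definition bcC (w : R[i]) : bicomplex R := Bicomplex w 0.
Definition bcR (a : R) : bicomplex R := bcC a%:C%C.
Definition bci : bicomplex R := bcC 'i%C.
Definition bcj : bicomplex R := Bicomplex 0 1.
Definition bck : bicomplex R := bci * bcj.
Definition bce1 : bicomplex R := bcC 2^-1 * (1 + bck).
Definition bce2 : bicomplex R := bcC 2^-1 * (1 - bck).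

(* The coordinates z1 and z2 in Z = e1 z1 + e2 z2; see [bicomplex_idemE] and
   [bicomplex_idem_uniq]. *)
Definition idem1 Z : R[i] := bc1 Z - 'i%C * bc2 Z.
Definition idem2 Z : R[i] := bc1 Z + 'i%C * bc2 Z.

Lemma bicomplexE Z : Z = bcC (bc1 Z) + bcj * bcC (bc2 Z).
Proof. by apply: bicomplexP => /=; ring. Qed.

Lemma bcj_sqr : bcj ^+ 2 = -1.
Proof. by apply: bicomplexP => /=; ring. Qed.

Lemma bci_sqr : bci ^+ 2 = -1.
Proof.
by apply: bicomplexP => /=;
  rewrite ?mulr0 ?mul0r ?subr0 ?addr0 ?oppr0 // -expr2 sqr_i.
Qed.

Lemma bck_sqr : bck ^+ 2 = 1.
Proof. by rewrite exprMn bci_sqr bcj_sqr mulrNN mulr1. Qed.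

Lemma bce1_sqr : bce1 ^+ 2 = bce1.
Proof.
have i2 : ('i%C : R[i]) ^+ 2 = -1 by exact: sqr_i.
by apply: bicomplexP => /=; field: i2.
Qed.

Lemma bce2_sqr : bce2 ^+ 2 = bce2.
Proof.
have i2 : ('i%C : R[i]) ^+ 2 = -1 by exact: sqr_i.
by apply: bicomplexP => /=; field: i2.
Qed.

Lemma bce1M2 : bce1 * bce2 = 0.
Proof.
have i2 : ('i%C : R[i]) ^+ 2 = -1 by exact: sqr_i.
by apply: bicomplexP => /=; field: i2.
Qed.

Lemma bce1D2 : bce1 + bce2 = 1.
Proof. by apply: bicomplexP => /=; field. Qed.

Lemma bicomplex_idemE Z : Z = bce1 * bcC (idem1 Z) + bce2 * bcC (idem2 Z).
Proof.
have i2 : ('i%C : R[i]) ^+ 2 = -1 by exact: sqr_i.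
by apply: bicomplexP; rewrite /= /idem1 /idem2; field: i2.
Qed.

Lemma bicomplex_idem_uniq Z z1 z2 :
  Z = bce1 * bcC z1 + bce2 * bcC z2 -> z1 = idem1 Z /\ z2 = idem2 Z.
Proof.
have i2 : ('i%C : R[i]) ^+ 2 = -1 by exact: sqr_i.
by move=> ->; split; rewrite /idem1 /idem2 /=; field: i2.
Qed.

Lemma idem1D Z W : idem1 (Z + W) = idem1 Z + idem1 W.
Proof. by rewrite /idem1 /=; ring. Qed.

Lemma idem2D Z W : idem2 (Z + W) = idem2 Z + idem2 W.
Proof. by rewrite /idem2 /=; ring. Qed.

End idempotents.

Section euclidean_norm.
Variable R : realType.
Implicit Types Z W : bicomplex R.

Definition bcnorm Z : R :=
  Num.sqrt ((normc (idem1 Z) ^+ 2 + normc (idem2 Z) ^+ 2) / 2).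

Let normcE (w : R[i]) : `|w| = (normc w)%:C%C. Proof. by []. Qed.

Let normc_ge0 (w : R[i]) : 0 <= normc w.
Proof. by rewrite -ler0c -normcE. Qed.

Let normcD (v w : R[i]) : normc (v + w) <= normc v + normc w.
Proof. by rewrite -lecR rmorphD /= -!normcE ler_normD. Qed.

Let normcN (w : R[i]) : normc (- w) = normc w.
Proof. by apply: complexI; rewrite -!normcE normrN. Qed.

Let normcMn (w : R[i]) n : normc (w *+ n) = normc w *+ n.
Proof. by apply: complexI; rewrite rmorphMn /= -!normcE normrMn. Qed.

Let bcnormE Z :
  bcnorm Z = normc (Complex (normc (idem1 Z)) (normc (idem2 Z))) * Num.sqrt 2^-1.
Proof. by rewrite /bcnorm sqrtrM // addr_ge0 ?sqr_ge0. Qed.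

Let normc_le (a b c d : R) : 0 <= a -> 0 <= b -> a <= c -> b <= d ->
  normc (Complex a b) <= normc (Complex c d).
Proof.
move=> a0 b0 ac bd; rewrite /normc ler_wsqrtr// lerD// lerXn2r// nnegrE//.
- exact: le_trans ac.
- exact: le_trans bd.
Qed.

Lemma bcnormD Z W : bcnorm (Z + W) <= bcnorm Z + bcnorm W.
Proof.
rewrite !bcnormE -mulrDl ler_wpM2r ?sqrtr_ge0// idem1D idem2D.
apply: le_trans (normcD _ _).
exact: (normc_le (normc_ge0 _) (normc_ge0 _) (normcD _ _) (normcD _ _)).
Qed.

Lemma bcnorm0_eq0 Z : bcnorm Z = 0 -> Z = 0.
Proof.
have s0 : Num.sqrt 2^-1 != 0 :> R by rewrite sqrtr_eq0 -ltNge invr_gt0.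
rewrite bcnormE => /eqP; rewrite mulf_eq0 (negbTE s0) orbF => /eqP/eq0_normc[].
move=> /eq0_normc z1 /eq0_normc z2; rewrite [Z]bicomplex_idemE z1 z2.
by apply: bicomplexP => /=; ring.
Qed.

Let idem1N Z : idem1 (- Z) = - idem1 Z. Proof. by rewrite /idem1 /=; ring. Qed.
Let idem2N Z : idem2 (- Z) = - idem2 Z. Proof. by rewrite /idem2 /=; ring. Qed.
Let idem10 : idem1 (0 : bicomplex R) = 0. Proof. by rewrite /idem1 /=; ring. Qed.
Let idem20 : idem2 (0 : bicomplex R) = 0. Proof. by rewrite /idem2 /=; ring. Qed.
Let idem1Mn Z n : idem1 (Z *+ n) = idem1 Z *+ n.
Proof. by elim: n => [|n IH]; [exact: idem10|rewrite !mulrS idem1D IH]. Qed.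
Let idem2Mn Z n : idem2 (Z *+ n) = idem2 Z *+ n.
Proof. by elim: n => [|n IH]; [exact: idem20|rewrite !mulrS idem2D IH]. Qed.

Lemma bcnormMn Z n : bcnorm (Z *+ n) = bcnorm Z *+ n.
Proof.
have cMn (a b : R) : Complex (a *+ n) (b *+ n) = Complex a b *+ n :> R[i].
  by elim: n => [//|n IH]; rewrite !mulrS -IH.
by rewrite !bcnormE idem1Mn idem2Mn !normcMn cMn normcMn mulrnAl.
Qed.

Lemma bcnormN Z : bcnorm (- Z) = bcnorm Z.
Proof. by rewrite /bcnorm idem1N idem2N !normcN. Qed.

HB.instance Definition _ := Num.Zmodule_isNormed.Build R (bicomplex R)
  bcnormD bcnorm0_eq0 bcnormMn bcnormN.
HB.instance Definition _ :=
  PseudoMetric.copy (bicomplex R) (pseudoMetric_normed (bicomplex R)).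
HB.instance Definition _ := isPointed.Build (bicomplex R) 0.
HB.instance Definition _ :=
  NormedZmod_PseudoMetric_eq.Build R (bicomplex R) erefl.

End euclidean_norm.

Section hyperbolic.
Variable R : realType.
Implicit Types Z W : bicomplex R.

Definition hyperbolic : set (bicomplex R) :=
  [set Z | exists a b : R, Z = bce1 R * bcR a + bce2 R * bcR b].

Definition hyp_nneg : set (bicomplex R) :=
  [set Z | exists a b : R,
    [/\ 0 <= a, 0 <= b & Z = bce1 R * bcR a + bce2 R * bcR b]].

Definition hyp_pos : set (bicomplex R) :=
  [set Z | exists a b : R,
    [/\ 0 < a, 0 < b & Z = bce1 R * bcR a + bce2 R * bcR b]].

(* Used between elements of [hyperbolic]; note that [hlt 0 Z] already forces
   [hyperbolic Z]. *)
Definition hle Z W : Prop := hyp_nneg (W - Z).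
Definition hlt Z W : Prop := hyp_pos (W - Z).

Definition hmod Z : bicomplex R :=
  bce1 R * bcR (normc (idem1 Z)) + bce2 R * bcR (normc (idem2 Z)).

Lemma hmodE (z1 z2 : R[i]) :
  hmod (bce1 R * bcC z1 + bce2 R * bcC z2) =
  bce1 R * bcR (normc z1) + bce2 R * bcR (normc z2).
Proof.
set Z := _ + _; rewrite /hmod.
by have [<- <-] := bicomplex_idem_uniq (erefl Z).
Qed.

End hyperbolic.

Notation "x <=h y" := (hle x y) (at level 70, no associativity) : ring_scope.
Notation "x <h y" := (hlt x y) (at level 70, no associativity) : ring_scope.

(* The library's topological modules are over a numDomainType, and HB cannot
   join Topological with Lmodule over another ring; hence the module axioms are
   fields here, and the lmodType (bicomplex R) structure is derived below. *)
HB.mixin Record isTopologicalBCModule (R : realType) X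
    & Topological X & GRing.Zmodule X := {
  bcscale : bicomplex R -> X -> X;
  bcscaleA : forall (a b : bicomplex R) (x : X),
    bcscale a (bcscale b x) = bcscale (a * b) x;
  bcscale1 : left_id 1 bcscale;
  bcscaleDr : right_distributive bcscale +%R;
  bcscaleDl : forall x : X, {morph bcscale^~ x : a b / a + b};
  bcmod_hausdorff : hausdorff_space X;
  bcadd_continuous : continuous (fun x : X * X => x.1 + x.2);
  bcscale_continuous :
    continuous (fun z : bicomplex R * X => bcscale z.1 z.2)
}.

#[short(type="topologicalBCModType")]
HB.structure Definition TopologicalBCModule (R : realType) :=
  {X of Topological X & GRing.Zmodule X & isTopologicalBCModule R X}.

HB.instance Definition _ (R : realType) (X : topologicalBCModType R) :=
  GRing.Zmodule_isLmodule.Build (bicomplex R) X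
    bcscaleA bcscale1 bcscaleDr bcscaleDl.

Section bc_modules.
Variables (R : realType) (X : topologicalBCModType R).

Definition bc_convex (B : set X) : Prop :=
  forall (x y : X) (l : bicomplex R), B x -> B y ->
    hyp_nneg l -> 0 <=h l -> l <=h 1 -> B (l *: x + (1 - l) *: y).

Definition locally_bc_convex : Prop :=
  forall U : set X, nbhs 0 U ->
    exists B : set X, [/\ nbhs 0 B, bc_convex B & B `<=` U].

Definition D_seminorm (p : X -> bicomplex R) : Prop :=
  [/\ forall x, hyperbolic (p x),
      forall (l : bicomplex R) (x : X), p (l *: x) = hmod l * p x
    & forall x y, p (x + y) <=h p x + p y].

Definition separated_family (P : set (X -> bicomplex R)) : Prop :=
  forall x : X, x != 0 -> exists2 p, P p & p x != 0.

Definition seminorm_base (P : set (X -> bicomplex R)) : set (set X) :=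
  [set U | exists (x : X) (eps : bicomplex R) (n : nat)
                  (p : 'I_n -> X -> bicomplex R),
    [/\ 0 <h eps, forall m, P (p m)
      & U = [set y | forall m, p m (y - x) <h eps]]].

Definition topology_generated_by_seminorms (P : set (X -> bicomplex R)) : Prop :=
  basis (seminorm_base P).

Definition D_metric (d : X -> X -> bicomplex R) : Prop :=
  [/\ forall x y, hyperbolic (d x y) /\ 0 <=h d x y,
      forall x y, d x y = 0 <-> x = y,
      forall x y, d x y = d y x
    & forall x y z, d x z <=h d x y + d y z].

Definition metric_base (d : X -> X -> bicomplex R) : set (set X) :=
  [set U | exists (x : X) (eps : bicomplex R),
    0 <h eps /\ U = [set y | d x y <h eps]].

Definition D_metrizable : Prop :=
  exists2 d : X -> X -> bicomplex R, D_metric d & basis (metric_base d).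

End bc_modules.
Arguments locally_bc_convex {R} X.
Arguments D_metrizable {R} X.

(* Main.v *)
Require Import Defs.
From mathcomp Require Import all_boot all_order all_algebra.
From mathcomp Require Import complex ring lra.
From mathcomp Require Import all_classical all_reals all_analysis.

(** Everything reduces to real-valued seminorms through the idempotent coordinates:
    the order on hyperbolic numbers is the product order on pairs of reals, and a
    module splits as [e1 X + e2 X], the scalar [e1 z1 + e2 z2] acting as the
    complex number [z1] on the first summand and as [z2] on the second.

    A hyperbolic metric generating the topology makes it first countable. Local
    convexity puts a BC-convex neighbourhood of zero inside each set of a countable
    neighbourhood base, and [balanced_convex_core] shrinks it to one stable under the
    scalars of hyperbolic modulus at most 1. The real Minkowski functional [gauge] of
    such a set, evaluated at [e1 x] and at [e2 x], gives the two coordinates of a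
    [D]-valued seminorm ([D_gauge_seminorm]). It is continuous ([D_gauge_ball]), and
    its open unit ball lies in the given set ([D_gauge_lt1]) because BC-convexity
    with [l = e1] glues the two components together. Hence these countably many
    seminorms generate the topology, and the Hausdorff property makes them separated.

    Conversely, let seminorms [p] carry distinct indices [f p] and have coordinates
    [q1 p] and [q2 p]. The usual Frechet construction applies to each coordinate:
    the supremum over [p] of [min (1 / (f p + 1), q p (y - x))] satisfies the triangle
    inequality, is small as soon as finitely many [q p (y - x)] are, and being small
    forces any chosen finite number of them to be small. The pair of these two
    real pseudometrics is a [D]-valued metric, since only the zero vector is
    annihilated by both coordinates of every [p], and it generates the same topology. *)

Set Implicit Arguments.
Unset Strict Implicit.
Unset Printing Implicit Defensive.

Import Order.TTheory GRing.Theory Num.Theory.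
Import ComplexField.Normc.

Local Open Scope classical_set_scope.
Local Open Scope ring_scope.

(** * Idempotent coordinates and hyperbolic numbers *)

Section idempotent_coordinates.
Variable R : realType.
Implicit Types Z W : bicomplex R.

Lemma idem_inj Z W : idem1 Z = idem1 W -> idem2 Z = idem2 W -> Z = W.
Proof. by move=> e1 e2; rewrite [Z]bicomplex_idemE [W]bicomplex_idemE e1 e2. Qed.

Lemma idem1N Z : idem1 (- Z) = - idem1 Z. Proof. by rewrite /idem1 /=; ring. Qed.
Lemma idem2N Z : idem2 (- Z) = - idem2 Z. Proof. by rewrite /idem2 /=; ring. Qed.

Lemma idem1M Z W : idem1 (Z * W) = idem1 Z * idem1 W.
Proof.
have i2 : ('i%C : R[i]) ^+ 2 = -1 by exact: sqr_i.
by rewrite /idem1 /=; ring: i2.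
Qed.

Lemma idem2M Z W : idem2 (Z * W) = idem2 Z * idem2 W.
Proof.
have i2 : ('i%C : R[i]) ^+ 2 = -1 by exact: sqr_i.
by rewrite /idem2 /=; ring: i2.
Qed.

Lemma idem1C (w : R[i]) : idem1 (bcC w) = w.
Proof. by rewrite /idem1 /= mulr0 subr0. Qed.

Lemma idem2C (w : R[i]) : idem2 (bcC w) = w.
Proof. by rewrite /idem2 /= mulr0 addr0. Qed.

Lemma idem1_e1 : idem1 (bce1 R) = 1.
Proof.
have [] // := @bicomplex_idem_uniq R (bce1 R) 1 0 _.
by apply: bicomplexP => /=; ring.
Qed.

Lemma idem2_e1 : idem2 (bce1 R) = 0.
Proof.
have [] // := @bicomplex_idem_uniq R (bce1 R) 1 0 _.
by apply: bicomplexP => /=; ring.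
Qed.

Lemma idem1_e2 : idem1 (bce2 R) = 0.
Proof.
have [] // := @bicomplex_idem_uniq R (bce2 R) 0 1 _.
by apply: bicomplexP => /=; ring.
Qed.

Lemma idem2_e2 : idem2 (bce2 R) = 1.
Proof.
have [] // := @bicomplex_idem_uniq R (bce2 R) 0 1 _.
by apply: bicomplexP => /=; ring.
Qed.

Lemma idem1_0 : idem1 (0 : bicomplex R) = 0. Proof. exact: idem1C. Qed.
Lemma idem2_0 : idem2 (0 : bicomplex R) = 0. Proof. exact: idem2C. Qed.
Lemma idem1_1 : idem1 (1 : bicomplex R) = 1. Proof. exact: idem1C. Qed.
Lemma idem2_1 : idem2 (1 : bicomplex R) = 1. Proof. exact: idem2C. Qed.

(** The hyperbolic number with idempotent coordinates [a] and [b]. In this form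
    the order, the sum and the product are all computed coordinatewise. *)
Definition hyp (a b : R) : bicomplex R := bce1 R * bcR a + bce2 R * bcR b.

Lemma idem1_hyp a b : idem1 (hyp a b) = a%:C%C.
Proof.
rewrite /hyp /bcR !(idem1D, idem1M, idem1C, idem1_e1, idem1_e2).
by rewrite mul1r mul0r addr0.
Qed.

Lemma idem2_hyp a b : idem2 (hyp a b) = b%:C%C.
Proof.
rewrite /hyp /bcR !(idem2D, idem2M, idem2C, idem2_e1, idem2_e2).
by rewrite mul1r mul0r add0r.
Qed.

(* The rules for [hyp] come first because [idem1D] would unfold it. *)
Definition idemE := (idem1_hyp, idem2_hyp, idem1D, idem2D, idem1N, idem2N,
  idem1M, idem2M, idem1C, idem2C, idem1_e1, idem2_e1, idem1_e2, idem2_e2,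
  idem1_0, idem2_0, idem1_1, idem2_1).

Lemma hyp_inj a b c d : hyp a b = hyp c d -> a = c /\ b = d.
Proof.
move=> e; split; apply: complexI.
  by rewrite -(idem1_hyp a b) e idem1_hyp.
by rewrite -(idem2_hyp a b) e idem2_hyp.
Qed.

Lemma hypD a b c d : hyp a b + hyp c d = hyp (a + c) (b + d).
Proof.
by apply: idem_inj; rewrite !idemE rmorphD.
Qed.

Lemma hypM a b c d : hyp a b * hyp c d = hyp (a * c) (b * d).
Proof.
by apply: idem_inj; rewrite !idemE rmorphM.
Qed.

Lemma hypB a b c d : hyp a b - hyp c d = hyp (a - c) (b - d).
Proof.
by apply: idem_inj; rewrite !idemE rmorphB.
Qed.

Lemma hyp_const a : hyp a a = bcR a.
Proof. by apply: idem_inj; rewrite !idemE. Qed.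

Lemma hyp00 : hyp 0 0 = 0.
Proof. by rewrite hyp_const. Qed.

Lemma hyp11 : hyp 1 1 = 1.
Proof. by rewrite hyp_const. Qed.

Lemma hleE a b c d : hyp a b <=h hyp c d <-> a <= c /\ b <= d.
Proof.
rewrite /hle hypB; split=> [[r [s [r0 s0 /hyp_inj[]]]]|[ac bd]].
  by move=> er es; rewrite -subr_ge0 er -[b <= d]subr_ge0 es.
by exists (c - a), (d - b); rewrite !subr_ge0.
Qed.

Lemma hltE a b c d : hyp a b <h hyp c d <-> a < c /\ b < d.
Proof.
rewrite /hlt hypB; split=> [[r [s [r0 s0 /hyp_inj[]]]]|[ac bd]].
  by move=> er es; rewrite -subr_gt0 er -[b < d]subr_gt0 es.
by exists (c - a), (d - b); rewrite !subr_gt0.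
Qed.

Lemma hle0E a b : 0 <=h hyp a b <-> 0 <= a /\ 0 <= b.
Proof. by rewrite -hyp00; exact: hleE. Qed.

Lemma hlt0E a b : 0 <h hyp a b <-> 0 < a /\ 0 < b.
Proof. by rewrite -hyp00; exact: hltE. Qed.

Lemma hlt0_hyp Z : 0 <h Z -> exists a b, [/\ 0 < a, 0 < b & Z = hyp a b].
Proof. by rewrite /hlt subr0. Qed.

(** On hyperbolic numbers, whose idempotent coordinates are real, taking real
    parts loses nothing ([hyperbolicE]). *)
Definition hre1 Z : R := complex.Re (idem1 Z).
Definition hre2 Z : R := complex.Re (idem2 Z).

Lemma hre1_hyp a b : hre1 (hyp a b) = a.
Proof. by rewrite /hre1 idem1_hyp. Qed.

Lemma hre2_hyp a b : hre2 (hyp a b) = b.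
Proof. by rewrite /hre2 idem2_hyp. Qed.

Lemma hyperbolicE Z : hyperbolic Z -> Z = hyp (hre1 Z) (hre2 Z).
Proof. by case=> a [b ->]; rewrite -/(hyp a b) hre1_hyp hre2_hyp. Qed.

Lemma bcRM (a b : R) : bcR (a * b) = bcR a * bcR b.
Proof. by apply: idem_inj; rewrite !idemE rmorphM. Qed.

Lemma normc_real (a : R) : normc a%:C%C = `|a|.
Proof. by rewrite /normc /= expr0n addr0 sqrtr_sqr. Qed.

Lemma normc_zero : normc (0 : R[i]) = 0.
Proof. by rewrite (normc_real 0) normr0. Qed.

Lemma normc_nonneg (w : R[i]) : 0 <= normc w.
Proof. by case: w => a b; exact: sqrtr_ge0. Qed.

(** The unit ball of the hyperbolic modulus, |c|_k <=' 1: a product of two complex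
    discs, hence stable under products, unlike the Euclidean unit ball. *)
Definition bc_disc : set (bicomplex R) :=
  [set c | normc (idem1 c) <= 1 /\ normc (idem2 c) <= 1].

Lemma bc_discM c d : bc_disc c -> bc_disc d -> bc_disc (c * d).
Proof.
by move=> [c1 c2] [d1 d2]; split; rewrite idemE normcM mulr_ile1 ?normc_nonneg.
Qed.

Lemma bc_disc1 : bc_disc 1.
Proof. by split; rewrite idemE -[1]/(1%:C%C) normc_real normr1. Qed.

Lemma bc_disc_hyp a b : 0 <= a <= 1 -> 0 <= b <= 1 -> bc_disc (hyp a b).
Proof.
by move=> /andP[a0 a1] /andP[b0 b1]; split; rewrite !idemE normc_real ger0_norm.
Qed.

Lemma bcnorm_discM c t : bc_disc c -> 0 <= t -> bcnorm (c * bcR t) <= t.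
Proof.
move=> [c1 c2] t0; rewrite /bcnorm !idemE !normcM !normc_real (ger0_norm t0).
rewrite -[leRHS](ger0_norm t0) -sqrtr_sqr ler_wsqrtr// !exprMn -mulrDl.
have := exprn_ile1 2 (normc_nonneg (idem1 c)) c1.
have := exprn_ile1 2 (normc_nonneg (idem2 c)) c2.
have := sqr_ge0 t; nra.
Qed.

End idempotent_coordinates.
Arguments hre1 {R} Z.
Arguments hre2 {R} Z.

(** * Neighbourhoods of zero in a topological module *)

Section neighbourhoods_of_zero.
Variables (R : realType) (X : topologicalBCModType R).
Implicit Types (x y : X) (V : set X).

Lemma nbhs_sub x V : nbhs 0 V -> \forall y \near x, V (y - x).
Proof.
move=> V0; have := @bcadd_continuous R X (x, - x).
rewrite /continuous_at /= subrr => /(_ V V0) /= [[A B] [/= Ax Bx] AB].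
apply: filterS Ax => y Ay; apply: (AB (y, - x)); split => //=.
exact: nbhs_singleton.
Qed.

Lemma nbhs_add x V : nbhs x V -> \forall z \near (0 : X), V (x + z).
Proof.
move=> Vx; have := @bcadd_continuous R X (x, 0).
rewrite /continuous_at /= addr0 => /(_ V Vx) /= [[A B] [/= Ax B0] AB].
apply: filterS B0 => z Bz; apply: (AB (x, z)); split => //=.
exact: nbhs_singleton.
Qed.

Lemma nbhs_scale (c : bicomplex R) V : nbhs (0 : X) V ->
  \forall x \near (0 : X), V (c *: x).
Proof.
move=> V0; have := @bcscale_continuous R X (c, 0).
rewrite /continuous_at /= -[bcscale c 0]/(c *: 0) scaler0 => /(_ V V0).
move=> [[A B] [/= Ac B0] AB].
apply: filterS B0 => z Bz; apply: (AB (c, z)); split => //=.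
exact: nbhs_singleton.
Qed.

(** Joint continuity of scalar multiplication at (0, x). Taken at [x = 0] it gives
    balanced neighbourhoods, and at a fixed [x] it gives absorption. *)
Lemma scale_near0 x V : nbhs 0 V -> exists2 d : R, 0 < d &
  \forall u \near x, forall c, bcnorm c < d -> V (c *: u).
Proof.
move=> V0; have := @bcscale_continuous R X (0, x).
rewrite /continuous_at /= -[bcscale 0 x]/(0 *: x) scale0r => /(_ V V0).
move=> [[A B] [/= A0 Bx] AB].
move/nbhs_normP: A0 => [d /= d0 dA]; exists d => //.
apply: filterS Bx => u Bu c cd; apply: (AB (c, u)); split => //=.
by apply: dA; rewrite /= sub0r normrN.
Qed.

Lemma absorb V x : nbhs 0 V -> exists2 r : R, 0 < r & V (bcR r *: x).
Proof.
move=> /(scale_near0 x)[d d0 /nbhs_singleton dV]; exists (d / 2); first lra.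
apply: dV; rewrite -[bcR _]mul1r.
by apply: le_lt_trans (bcnorm_discM (@bc_disc1 R) _) _; lra.
Qed.

Definition bc_balanced V : Prop :=
  forall c x, bc_disc c -> V x -> V (c *: x).

(** The core of [V] consists of the points whose multiples by [bc_disc] all lie in
    [V]. It is convex because it is an intersection of preimages of [V] under
    linear maps, and a neighbourhood of zero because scalars of small norm send a
    whole neighbourhood of zero into [V]. *)
Lemma balanced_convex_core V : bc_convex V -> nbhs 0 V ->
  exists W : set X, [/\ nbhs 0 W, bc_convex W, bc_balanced W & W `<=` V].
Proof.
move=> cV V0; exists [set x | forall c, bc_disc c -> V (c *: x)]; split.
- have [d d0 dV] := scale_near0 0 V0.
  (* The core contains (d / 2) U, where all scalars of norm < d map U into V. *)
  have d20 : 0 < d / 2 by lra.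
  apply: filterS (nbhs_scale (bcR (d / 2)^-1) dV) => x /= xV c cD.
  have := xV (c * bcR (d / 2)); rewrite scalerA -mulrA -bcRM divff ?gt_eqF// mulr1.
  by apply; apply: le_lt_trans (bcnorm_discM cD _) _; lra.
- move=> x y l Vx Vy l0 l1 l2 c cD; rewrite scalerDr !scalerA !(mulrC c) -!scalerA.
  by apply: cV => //; [exact: Vx|exact: Vy].
- by move=> c x cD Vx b bD; rewrite scalerA; apply: Vx; exact: bc_discM.
- by move=> x /(_ _ (@bc_disc1 R)); rewrite scale1r.
Qed.

End neighbourhoods_of_zero.

(** * The hyperbolic gauge of a balanced convex neighbourhood *)

Section gauge.
Variables (R : realType) (X : topologicalBCModType R) (W : set X).
Hypotheses (W0 : nbhs 0 W) (cW : bc_convex W) (bW : bc_balanced W).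
Implicit Types (x y : X) (r s t : R).

Let radii x : set R := [set r | 0 < r /\ W (bcR r^-1 *: x)].

(** The real Minkowski functional. It is only a seminorm over the complex scalars
    [bcC w]: for a general [c], [gaugeZ_le] bounds it by the larger of the two
    moduli of the idempotent coordinates of [c]. *)
Definition gauge x : R := inf (radii x).

Let radii0 x : radii x !=set0.
Proof.
have [r r0 Wr] := absorb x W0; exists r^-1; split; first by rewrite invr_gt0.
by rewrite invrK.
Qed.

Let radii_lb x : lbound (radii x) 0.
Proof. by move=> r [/ltW]. Qed.

Lemma gauge_ge0 x : 0 <= gauge x.
Proof. exact: lb_le_inf. Qed.

Lemma gauge_le x r : 0 < r -> W (bcR r^-1 *: x) -> gauge x <= r.
Proof. by move=> r0 Wr; apply: ge_inf => //; exists 0; exact: radii_lb. Qed.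

Lemma gauge_lt x r : gauge x < r -> W (bcR r^-1 *: x).
Proof.
move=> /inf_lt[] // s [s0 Ws] sr; have r0 := lt_trans s0 sr.
have -> : bcR r^-1 = bcR (s / r) * bcR s^-1.
  by rewrite -bcRM mulrAC divff ?mul1r// gt_eqF.
rewrite -scalerA; apply: bW => //; rewrite -hyp_const.
by apply: bc_disc_hyp; rewrite divr_ge0 ?ler_pdivrMr ?mul1r ?ltW.
Qed.

Lemma gaugeD x y : gauge (x + y) <= gauge x + gauge y.
Proof.
apply/ler_addgt0Pr => e e0.
have [gx gy] := (gauge_ge0 x, gauge_ge0 y).
pose r := gauge x + e / 2; pose s := gauge y + e / 2.
have -> : gauge x + gauge y + e = r + s by rewrite /r /s; lra.
have r0 : 0 < r by rewrite /r; lra.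
have s0 : 0 < s by rewrite /s; lra.
have Wx : W (bcR r^-1 *: x) by apply: gauge_lt; rewrite /r; lra.
have Wy : W (bcR s^-1 *: y) by apply: gauge_lt; rewrite /s; lra.
apply: gauge_le; first lra.
have rs0 : r + s != 0 by rewrite gt_eqF//; lra.
pose l := r / (r + s).
have l01 : 0 <= l <= 1.
  by rewrite divr_ge0 ?ler_pdivrMr ?mul1r; lra.
have /andP[l0 l1] := l01.
have /(cW Wx Wy) : hyp_nneg (hyp l l) by exists l, l.
have le0 : 0 <=h hyp l l by apply/hle0E.
have le1 : hyp l l <=h 1.
  by rewrite -hyp11; apply/hleE.
move=> /(_ le0 le1); rewrite hyp_const -[1]/(bcR 1) !scalerA.
have -> : bcR 1 - bcR l = bcR (1 - l).
  by apply: idem_inj; rewrite !idemE rmorphB.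
rewrite -!bcRM scalerDr; congr (W (bcR _ *: _ + bcR _ *: _)); rewrite /l; field.
  by rewrite rs0 gt_eqF.
by rewrite rs0 gt_eqF.
Qed.

Lemma gaugeZ_le (c : bicomplex R) t x : 0 < t ->
  normc (idem1 c) <= t -> normc (idem2 c) <= t -> gauge (c *: x) <= t * gauge x.
Proof.
move=> t0 c1 c2; rewrite -ler_pdivrMl//; apply: lb_le_inf => // r [r0 Wr].
rewrite ler_pdivrMl//; apply: gauge_le; first exact: mulr_gt0.
have -> : bcR (t * r)^-1 *: (c *: x) = (bcR t^-1 * c) *: (bcR r^-1 *: x).
  by rewrite !scalerA invfM bcRM mulrAC.
apply: bW => //; split; rewrite !idemE normcM normc_real ger0_norm ?invr_ge0 ?(ltW t0)//.
  by rewrite mulrC ler_pdivrMr ?mul1r.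
by rewrite mulrC ler_pdivrMr ?mul1r.
Qed.

(** For nonzero [w], the upper bounds for [w] and for its inverse combine into an
    equality. *)
Lemma gaugeZ (w : R[i]) x : gauge (bcC w *: x) = normc w * gauge x.
Proof.
have le v y : gauge (bcC v *: y) <= normc v * gauge y.
  have nv := normc_nonneg v; have gy := gauge_ge0 y.
  apply/ler_addgt0Pr => e e0.
  (* [gaugeZ_le] needs a positive radius, but v may be zero: enlarge |v| by an
     amount costing at most e after multiplication by gauge y. *)
  have t0 : 0 < normc v + e / (gauge y + 1).
    by apply: ltr_wpDl => //; apply: divr_gt0 => //; lra.
  apply: (le_trans (gaugeZ_le y t0 _ _)); rewrite ?idemE.
  - by rewrite lerDl divr_ge0; lra.
  - by rewrite lerDl divr_ge0; lra.
  - by rewrite mulrDl lerD2l mulrAC ler_pdivrMr; nra.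
apply/eqP; rewrite eq_le le /=.
have [->|w0] := eqVneq w 0; first by rewrite normc_zero mul0r gauge_ge0.
have nw : 0 < normc w.
  by rewrite lt_neqAle normc_nonneg andbT eq_sym; apply/eqP => /eq0_normc/eqP; apply/negP.
have := le w^-1 (bcC w *: x).
rewrite scalerA.
have -> : bcC w^-1 * bcC w = 1.
  by apply: idem_inj; rewrite !idemE mulVf.
have -> : normc w^-1 = (normc w)^-1.
  apply: (mulfI (lt0r_neq0 nw)); rewrite -normcM divff// divff ?gt_eqF//.
  by rewrite -[1]/(1%:C%C) normc_real normr1.
by rewrite scale1r ler_pdivlMl.
Qed.

(** Each idempotent component of [X] is a complex vector space, on which the real
    gauge is a seminorm; the two seminorms are the coordinates of a [D]-valued one,
    since [c] acts on the first component as the complex number [idem1 c] and on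
    the second as [idem2 c]. *)
Definition D_gauge x : bicomplex R :=
  hyp (gauge (bce1 R *: x)) (gauge (bce2 R *: x)).

Lemma D_gauge_seminorm : D_seminorm D_gauge.
Proof.
split=> [x|c x|x y].
- by exists (gauge (bce1 R *: x)), (gauge (bce2 R *: x)).
- rewrite /D_gauge /hmod -/(hyp _ _) hypM -!gaugeZ !scalerA.
  by congr (hyp (gauge (_ *: x)) (gauge (_ *: x))); apply: idem_inj;
     rewrite !idemE ?mul1r ?mul0r ?mulr0 ?mulr1.
- by rewrite /D_gauge hypD !scalerDr; apply/hleE; split; exact: gaugeD.
Qed.

(** A BC-convex set contains [e1 y + e2 z] as soon as it contains [y] and [z],
    because [e1] is a hyperbolic number between 0 and 1 and [1 - e1 = e2]. Hence
    bounds on the two coordinates of the gauge suffice. *)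
Lemma D_gauge_lt1 x : D_gauge x <h 1 -> W x.
Proof.
rewrite -hyp11 => /hltE[/gauge_lt + /gauge_lt].
rewrite invr1 -[bcR 1]/(1 : bicomplex R) !scale1r => W1 W2.
have e1 : bce1 R = hyp 1 0 by apply: idem_inj; rewrite !idemE.
have l0 : hyp_nneg (bce1 R) by exists 1, 0; split => //; rewrite -e1.
have le0 : 0 <=h bce1 R by rewrite e1; apply/hle0E.
have le1 : bce1 R <=h 1.
  by rewrite -hyp11 e1; apply/hleE.
have := cW W1 W2 l0 le0 le1.
rewrite !scalerA -scalerDl; congr (W _); rewrite -[RHS]scale1r; congr (_ *: _).
by apply: idem_inj; rewrite !idemE; ring.
Qed.

(** The radius [e] may have unequal coordinates; the real radius [r] lies below
    both. *)
Lemma D_gauge_ball e : 0 <h e -> \forall x \near (0 : X), D_gauge x <h e.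
Proof.
move=> /hlt0_hyp[a [b [a0 b0 ->]]].
pose r := Num.min a b / 2.
have m0 : 0 < Num.min a b by rewrite lt_min a0.
have r0 : 0 < r by rewrite /r; lra.
have [ra rb] : r < a /\ r < b.
  have : Num.min a b <= a by rewrite ge_min lexx.
  have : Num.min a b <= b by rewrite ge_min lexx orbT.
  by rewrite /r; lra.
apply: filterS2 (nbhs_scale (bcR r^-1 * bce1 R) W0)
  (nbhs_scale (bcR r^-1 * bce2 R) W0) => x.
rewrite -(scalerA _ (bce1 R)) -(scalerA _ (bce2 R)) => W1 W2.
apply/hltE; split; [apply: le_lt_trans ra|apply: le_lt_trans rb];
  exact: gauge_le.
Qed.

End gauge.

(** * Coordinates of a hyperbolic-valued seminorm *)

Section group_seminorms.
Variables (R : realType) (X : topologicalBCModType R).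
Implicit Types (x y : X) (q : X -> R) (p : X -> bicomplex R).

(** What is left of a seminorm when homogeneity is dropped. Truncation at a constant
    preserves this notion but not homogeneity, so it is the one adapted to
    building metrics. *)
Definition group_seminorm q : Prop :=
  [/\ forall x, 0 <= q x, q 0 = 0, forall x, q (- x) = q x
    & forall x y, q (x + y) <= q x + q y].

Lemma D_seminorm_coord p : D_seminorm p ->
  [/\ forall x, p x = hyp (hre1 (p x)) (hre2 (p x)),
      group_seminorm (hre1 \o p) & group_seminorm (hre2 \o p)].
Proof.
move=> [ph pZ pD]; have pE x := hyperbolicE (ph x).
have p0 : p 0 = 0.
  rewrite -[0 in LHS](scale0r (0 : X)) pZ.
  by rewrite /hmod -/(hyp _ _) idem1_0 idem2_0 normc_zero hyp00 mul0r.
have pN x : p (- x) = p x.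
  rewrite -scaleN1r pZ /hmod -/(hyp _ _) !idemE.
  have -> : - 1 = (-1)%:C%C :> R[i] by rewrite rmorphN1.
  by rewrite normc_real normrN1 hyp_const mul1r.
have D x y : hre1 (p (x + y)) <= hre1 (p x) + hre1 (p y) /\
             hre2 (p (x + y)) <= hre2 (p x) + hre2 (p y).
  by apply/hleE; rewrite -hypD -!pE.
have h0 : hre1 0 = 0 :> R /\ hre2 0 = 0 :> R.
  by rewrite -hyp00 hre1_hyp hre2_hyp.
split=> //; split=> [x||x|x y] /=; rewrite ?p0 ?pN ?h0 //.
- by have [+ _] := D x (- x); rewrite subrr p0 h0.1 pN; lra.
- exact: h0.1.
- by have [] := D x y.
- by have [_ +] := D x (- x); rewrite subrr p0 h0.2 pN; lra.
- exact: h0.2.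
- by have [] := D x y.
Qed.

End group_seminorms.

(** * From a hyperbolic metric to countably many seminorms *)

Section seminorms_of_metric.
Variables (R : realType) (X : topologicalBCModType R).
Implicit Types (x y : X) (p : X -> bicomplex R).

Lemma seminorm_in_nbhs (U : set X) : locally_bc_convex X -> nbhs 0 U ->
  exists p, [/\ D_seminorm p,
    forall e, 0 <h e -> \forall x \near (0 : X), p x <h e
    & [set x | p x <h 1] `<=` U].
Proof.
move=> lcX /lcX[V [V0 cV VU]].
have [W [W0 cW bW WV]] := balanced_convex_core cV V0.
exists (D_gauge W); split; first exact: D_gauge_seminorm.
- by move=> e; exact: D_gauge_ball.
- by move=> x /D_gauge_lt1 Wx; apply/VU/WV; exact: Wx.
Qed.

Lemma open_seminorm_ball p x e : D_seminorm p ->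
  (forall e, 0 <h e -> \forall x \near (0 : X), p x <h e) ->
  open [set y | p (y - x) <h e].
Proof.
move=> sp pc; have [pE [_ _ _ D1] [_ _ _ D2]] := D_seminorm_coord sp.
rewrite openE => y /= ye.
have e0 : 0 <h e - p (y - x) by rewrite /hlt subr0.
have [a [b [a0 b0 ab]]] := hlt0_hyp e0.
have eE : e = hyp (hre1 (p (y - x)) + a) (hre2 (p (y - x)) + b).
  by rewrite -hypD -ab -pE addrC subrK.
apply: filterS (nbhs_sub y (pc _ e0)) => z.
rewrite ab pE => /hltE[z1 z2]; rewrite /= eE (pE (z - x)); apply/hltE.
have -> : z - x = (y - x) + (z - y) by rewrite [RHS]addrC addrA subrK.
by have := D1 (y - x) (z - y); have := D2 (y - x) (z - y); rewrite /=; lra.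
Qed.

(** The balls of radius [1 / (n + 1)] centred at zero form a countable neighbourhood
    base at zero, so the gauges of convex sets inside them generate the topology,
    and they separate points because the topology is Hausdorff. *)
Lemma seminorms_of_D_metric : locally_bc_convex X -> D_metrizable X ->
  exists P : set (X -> bicomplex R),
    [/\ countable P, P `<=` @D_seminorm R X, separated_family P
      & topology_generated_by_seminorms P].
Proof.
move=> lcX [d [dh d0 _ dT] [dopen dbase]].
have dE x y : d x y = hyp (hre1 (d x y)) (hre2 (d x y)).
  by apply: hyperbolicE; have [] := dh x y.
pose r n : R := n.+1%:R^-1.
have r0 n : 0 < r n by rewrite invr_gt0.
pose B n : set X := [set y | d 0 y <h bcR (r n)].
have B0 n : nbhs 0 (B n).
  apply: open_nbhs_nbhs; split.
    apply: dopen; exists 0, (bcR (r n)); split => //.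
    by rewrite -hyp_const; apply/hlt0E.
  have /d0 := erefl (0 : X); rewrite /B /= => ->.
  by rewrite -hyp_const; apply/hlt0E.
have /choice[p pP] n := seminorm_in_nbhs lcX (B0 n).
(* A base ball containing zero need not be centred there; the triangle inequality
   leaves room for a small ball centred at zero. *)
have small N : nbhs (0 : X) N -> exists n, [set x | p n x <h 1] `<=` N.
  move=> /dbase[_ [[c [e [e0 ->]]] /= ce] eN].
  have e'0 : 0 <h e - d c 0 by rewrite /hlt subr0.
  have [a [b [a0 b0 ab]]] := hlt0_hyp e'0.
  have m0 : 0 < Num.min a b by rewrite lt_min a0.
  have [n rn] := ltr_add_invr m0; rewrite add0r -/(r n) in rn.
  exists n => x; have [_ _ pB] := pP n => /pB; rewrite /B /= => xB.
  apply: eN => /=.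
  move: xB rn; rewrite dE -hyp_const lt_min => /hltE[x1 x2] /andP[ra rb].
  have eE : e = hyp (hre1 (d c 0) + a) (hre2 (d c 0) + b).
    by rewrite -hypD -ab -dE addrC subrK.
  have := dT c 0 x; rewrite (dE c 0) (dE 0 x) (dE c x) hypD eE => /hleE[t1 t2].
  by apply/hltE; lra.
exists (range p); split.
- exact: card_image_le.
- by move=> _ [n _ <-]; have [] := pP n.
- move=> x; rewrite eq_sym => x0.
  have [A [Aopen /set_mem A0 /set_mem Ax]] :=
    hausdorff_accessible (@bcmod_hausdorff R X) x0.
  have [n nA] : exists n, [set x | p n x <h 1] `<=` A.
    by apply: small; exact: open_nbhs_nbhs.
  exists (p n); first by exists n.
  apply/eqP => pnx; apply: Ax; apply: nA.
  by rewrite /= pnx -hyp00 -hyp11; apply/hltE.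
- split=> [_ [x [e [n [q [e0 qP ->]]]]]|x N].
    rewrite openE => y /= ye; apply: filter_forall => m.
    have [k _ qk] := qP m; have [sp pc _] := pP k.
    rewrite -qk.
    apply: open_nbhs_nbhs; split; last by rewrite /= qk; exact: ye.
    exact: open_seminorm_ball.
  move=> /nbhs_add/small[n nN]; have [sp _ _] := pP n.
  have [pE [_ p10 _ _] [_ p20 _ _]] := D_seminorm_coord sp.
  have lt01 : (0 : bicomplex R) <h 1.
    by rewrite -hyp11; apply/hlt0E.
  exists [set y | p n (y - x) <h 1] => /=.
    split; last by rewrite /= subrr pE [hre1 _]p10 [hre2 _]p20 hyp00.
    exists x, 1, 1%N, (fun=> p n); split=> //.
    by apply/seteqP; split=> y //= /(_ ord0).
  by move=> y /= /nN; rewrite /= addrC subrK.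
Qed.

End seminorms_of_metric.

(** * The truncated supremum of a countable family *)

Section metric_of_seminorms.
Variables (R : realType) (X : topologicalBCModType R) (T : Type).
Variables (P : set T) (f : T -> nat) (q : T -> X -> R).
Hypothesis qP : forall p, P p -> group_seminorm (q p).
Implicit Types (x y : X) (p : T) (e : R).

Let w p : R := (f p).+1%:R^-1.

(* The element 0 matters when P is empty: the supremum is then 0. *)
Let terms x : set R :=
  [set 0] `|` [set t | exists2 p, P p & t = Num.min (w p) (q p x)].

(** Truncating the member [p] at [1 / (f p + 1)] makes the supremum finite, and small
    as soon as the finitely many members of low index are small. *)
Definition sup_seminorm x : R := sup (terms x).

Let w_gt0 p : 0 < w p. Proof. by rewrite invr_gt0. Qed.

Let terms_ub x : has_ubound (terms x).
Proof.
exists 1 => t [->|[p _ ->]]; first exact: ler01.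
by rewrite ge_min invf_le1 ?ler1n// ltr0n.
Qed.

Lemma sup_seminorm_ge p x : P p -> Num.min (w p) (q p x) <= sup_seminorm x.
Proof. by move=> Pp; apply: ub_le_sup => //; right; exists p. Qed.

Lemma sup_seminorm_le x e : 0 <= e ->
  (forall p, P p -> Num.min (w p) (q p x) <= e) -> sup_seminorm x <= e.
Proof.
move=> e0 ple; apply: ge_sup; first by exists 0; left.
by move=> t [->//|[p Pp ->]]; exact: ple.
Qed.

Lemma sup_seminorm_group : group_seminorm sup_seminorm.
Proof.
have ge0 x : 0 <= sup_seminorm x by apply: ub_le_sup => //; left.
split=> // [|x|x y].
- apply/eqP; rewrite eq_le ge0 andbT; apply: sup_seminorm_le => // p Pp.
  by have [_ -> _ _] := qP Pp; rewrite ge_min lexx orbT.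
- rewrite /sup_seminorm; congr sup; congr (_ `|` _).
  by apply/seteqP; split=> t [p Pp ->]; exists p => //;
     have [_ _ -> _] := qP Pp.
- apply: sup_seminorm_le => [|p Pp]; first exact: addr_ge0.
  have [q0 _ _ qD] := qP Pp; have := qD x y.
  have := sup_seminorm_ge x Pp; have := sup_seminorm_ge y Pp.
  have qx := q0 x; have qy := q0 y; have w0 := w_gt0 p.
  by rewrite /Order.min; do 3! case: ltP => ?; move=> ? ? ?; lra.
Qed.

(** Below its truncation level, a member of the family is controlled by the
    supremum. *)
Lemma sup_seminorm_lt p x e : P p -> e <= w p ->
  sup_seminorm x < e -> q p x < e.
Proof.
move=> Pp ew xe; have := le_lt_trans (sup_seminorm_ge x Pp) xe.
by rewrite gt_min ltNge ew.
Qed.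

(** Truncation disposes of all members of index at least [n], where
    [1 / (n + 1) < e]. *)
Lemma sup_seminorm_small e : 0 < e -> exists n, forall x,
  (forall p, P p -> (f p < n)%N -> q p x < e) -> sup_seminorm x <= e.
Proof.
move=> e0; have [n ne] := ltr_add_invr e0; exists n => x xn.
rewrite add0r in ne.
apply: sup_seminorm_le => [|p Pp]; first exact: ltW.
rewrite ge_min; case: (ltnP (f p) n) => fp.
  by rewrite (ltW (xn _ _ _)) ?orbT.
apply/orP; left; apply: le_trans (ltW ne); rewrite lef_pV2 ?posrE ?ltr0n//.
by rewrite ler_nat ltnS.
Qed.

End metric_of_seminorms.

(** * From countably many seminorms to a hyperbolic metric *)

Section metrization.
Variables (R : realType) (X : topologicalBCModType R).
Implicit Types (x y : X).

(** Injectivity of [f] leaves at most one condition per index, so only finitely many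
    neighbourhoods are intersected. *)
Lemma near_lt_level (T : Type) (P : set T) (f : T -> nat) (A : T -> set X) x n :
  {in P &, injective f} -> (forall p, P p -> nbhs x (A p)) ->
  \forall y \near x, forall p, P p -> (f p < n)%N -> A p y.
Proof.
move=> finj PA; elim: n => [|n IH]; first exact: nearW.
have [[p0 [Pp0 fp0]]|no] := pselect (exists p, P p /\ f p = n).
  apply: filterS2 IH (PA _ Pp0) => y yn yp0 p Pp; rewrite ltnS leq_eqVlt.
  move=> /orP[/eqP fp|]; last exact: yn.
  by rewrite (finj p p0) ?inE// fp.
apply: filterS IH => y yn p Pp; rewrite ltnS leq_eqVlt => /orP[/eqP fp|].
  by exfalso; apply: no; exists p.
exact: yn.
Qed.

(** The metric is the pair of truncated suprema of the two coordinates of the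
    family, evaluated at [y - x]. Small balls are neighbourhoods by
    [sup_seminorm_small], and balls fit into seminorm neighbourhoods by
    [sup_seminorm_lt]. *)
Lemma D_metric_of_seminorms (P : set (X -> bicomplex R)) :
  countable P -> P `<=` @D_seminorm R X -> separated_family P ->
  topology_generated_by_seminorms P -> D_metrizable X.
Proof.
move=> /countable_injP[f finj] PD sepP [Popen Pbase].
pose q1 (p : X -> bicomplex R) x := hre1 (p x).
pose q2 (p : X -> bicomplex R) x := hre2 (p x).
have g1 p : P p -> group_seminorm (q1 p) by move=> /PD/D_seminorm_coord[].
have g2 p : P p -> group_seminorm (q2 p) by move=> /PD/D_seminorm_coord[].
have pE p x : P p -> p x = hyp (q1 p x) (q2 p x).
  by move=> /PD/D_seminorm_coord[].
pose s1 := sup_seminorm P f q1; pose s2 := sup_seminorm P f q2.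
have [s1ge0 s10 s1N s1D] : group_seminorm s1 by exact: sup_seminorm_group.
have [s2ge0 s20 s2N s2D] : group_seminorm s2 by exact: sup_seminorm_group.
pose d x y := hyp (s1 (y - x)) (s2 (y - x)).
have near_ball x a b : 0 < a -> 0 < b ->
    \forall y \near x, s1 (y - x) <= a /\ s2 (y - x) <= b.
  move=> a0 b0.
  have [n1 sn1] := sup_seminorm_small P f q1 a0.
  have [n2 sn2] := sup_seminorm_small P f q2 b0.
  have nb p : P p -> nbhs x [set y | p (y - x) <h hyp a b].
    move=> Pp; apply: open_nbhs_nbhs; split; last first.
      rewrite /= subrr pE//; apply/hltE.
      by have [_ -> _ _] := g1 _ Pp; have [_ -> _ _] := g2 _ Pp.
    apply: Popen; exists x, (hyp a b), 1%N, (fun=> p); split => //.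
      by apply/hlt0E.
    by apply/seteqP; split=> y //= /(_ ord0).
  apply: filterS (near_lt_level (maxn n1 n2) finj nb) => y /= yn; split.
    apply: sn1 => p Pp fp; have := yn p Pp; rewrite leq_max fp => /(_ isT).
    by rewrite pE// => /hltE[].
  apply: sn2 => p Pp fp; have := yn p Pp; rewrite leq_max fp orbT => /(_ isT).
  by rewrite pE// => /hltE[].
exists d; [split|split].
- move=> x y; split; first by exists (s1 (y - x)), (s2 (y - x)).
  exact/hle0E.
- move=> x y; split=> [|->]; last by rewrite /d subrr s10 s20 hyp00.
  rewrite /d -hyp00 => /hyp_inj[e1 e2]; apply/eqP; rewrite eq_sym -subr_eq0.
  apply: contrapT => /negP/sepP[p Pp]; rewrite pE//.
  have w0 : 0 < (f p).+1%:R^-1 :> R by rewrite invr_gt0.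
  have zero q : group_seminorm (q p) ->
      sup_seminorm P f q (y - x) = 0 -> q p (y - x) = 0.
    move=> [q0 _ _ _] s0; apply/eqP; rewrite eq_le q0 andbT leNgt; apply/negP => qp.
    have := sup_seminorm_ge f q (y - x) Pp.
    by rewrite s0 ge_min !leNgt w0 qp.
  by rewrite (zero q1)// ?(zero q2)// ?hyp00 ?eqxx//; [exact: g2|exact: g1].
- by move=> x y; rewrite /d -[y - x]opprB s1N s2N.
- move=> x y z; rewrite /d hypD; apply/hleE.
  have -> : z - x = (y - x) + (z - y) by rewrite [RHS]addrC addrA subrK.
  by split; [exact: s1D|exact: s2D].
- move=> _ [x [e [e0 ->]]]; rewrite openE => y /= ye.
  have e'0 : 0 <h e - d x y by rewrite /hlt subr0.
  have [a [b [a0 b0 ab]]] := hlt0_hyp e'0.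
  have eE : e = hyp (s1 (y - x) + a) (s2 (y - x) + b).
    by rewrite -hypD -ab addrC subrK.
  have a20 : 0 < a / 2 by lra.
  have b20 : 0 < b / 2 by lra.
  apply: filterS (near_ball y _ _ a20 b20) => z [za zb].
  rewrite eE /d; apply/hltE.
  have -> : z - x = (y - x) + (z - y) by rewrite [RHS]addrC addrA subrK.
  by have := s1D (y - x) (z - y); have := s2D (y - x) (z - y); lra.
- move=> x N /Pbase[_ [[c [e [n [p [e0 Pp ->]]]]] /= xe] eN].
  (* A base set containing x need not be centred at x: g m is a real radius that
     fits in the gap left by p m (x - c), below the truncation level of p m. *)
  have /choice[g gP] m : exists g : R, [/\ 0 < g, g <= (f (p m)).+1%:R^-1 &
      p m (x - c) + bcR g <=h e].
    have e'0 : 0 <h e - p m (x - c) by rewrite /hlt subr0; exact: xe.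
    have [a [b [a0 b0 ab]]] := hlt0_hyp e'0.
    exists (Num.min (Num.min a b) (f (p m)).+1%:R^-1).
    rewrite !lt_min a0 b0 invr_gt0 ltr0n ge_min lexx orbT; split => //.
    rewrite -(subrK (p m (x - c)) e) ab addrC pE// -hyp_const !hypD.
    by apply/hleE; split; rewrite lerD2r !ge_min lexx ?orbT.
  pose r := \big[Num.min/1]_m g m.
  have r0 : 0 < r by apply/bigmin_gtP; split => // m _; have [] := gP m.
  have rg m : r <= g m by apply: bigmin_le_cond.
  exists [set y | d x y <h hyp r r].
    split; first by exists x, (hyp r r); split => //; apply/hlt0E.
    by rewrite /= /d subrr s10 s20; apply/hltE.
  move=> y /= /hltE[y1 y2]; apply: eN => m /=.
  have [_ gw gle] := gP m; have rw := le_trans (rg m) gw.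
  have p1 := sup_seminorm_lt (Pp m) rw y1.
  have p2 := sup_seminorm_lt (Pp m) rw y2.
  have [_ _ _ D1] := g1 _ (Pp m); have [_ _ _ D2] := g2 _ (Pp m).
  have := D1 (x - c) (y - x); have := D2 (x - c) (y - x).
  have -> : (x - c) + (y - x) = y - c by rewrite addrC addrA subrK.
  have [u [v [u0 v0 uv]]] := gle.
  have := rg m.
  rewrite (pE _ (y - c))//.
  have -> : e = hyp (q1 (p m) (x - c) + g m + u) (q2 (p m) (x - c) + g m + v).
    rewrite -[LHS](subrK (p m (x - c) + bcR (g m))) uv -/(hyp u v) pE//.
    by rewrite -hyp_const !hypD; congr hyp; lra.
  by move=> ? ? ?; apply/hltE; lra.
Qed.

End metrization.

(** * The metrization theorem *)

Theorem theorem5p11 (R : realType) (X : topologicalBCModType R) :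
  locally_bc_convex X ->
  (D_metrizable X <->
   exists P : set (X -> bicomplex R),
     [/\ countable P,
         P `<=` @D_seminorm R X,
         separated_family P
       & topology_generated_by_seminorms P]).
Proof.
move=> lcX; split; first exact: seminorms_of_D_metric.
by move=> [P [cP PD sepP gP]]; exact: D_metric_of_seminorms gP.
Qed.
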